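(* Let $n\ge1$ and let $\mathbb{T}_n=\{(a\,b):a,b\in[n],a\ne b\}$ be the set of all transpositions in $\mathbb{S}_n$. A weighted $\mathbb{T}_n$-distance exists, and any weighted $\mathbb{T}_n$-distance $\mathsf{d}$ is uniquely determined by the values $\mathsf{d}(\tau,e)$, $\tau\in\mathbb{T}_n$, namely, for all $\pi,\sigma\in\mathbb{S}_n$, $$\mathsf{d}(\pi,\sigma)=\min_{(\tau_1,\dots,\tau_m)\in A_{\mathbb{T}_n}(\pi,\sigma)}\sum_{i=1}^m\mathsf{d}(\tau_i,e).$$
   Context: $\mathbb{S}_n$ is the symmetric group on $[n]=\{1,\dots,n\}$ with identity $e$; products are compositions, $(\pi\sigma)(i)=\pi(\sigma(i))$. Let $G\subseteq\mathbb{S}_n$ be closed under inverses (here $G=\mathbb{T}_n$). Rankings $\pi,\sigma\in\mathbb{S}_n$ are $G$-adjacent if $\pi=\sigma g$ for some $g\in G$. A $G$-transformation of $\pi$ into $\sigma$ is a finite sequence $(g_1,\dots,g_k)$, $k\ge0$, of elements of $G$ with $\sigma=\pi g_1g_2\cdots g_k$; $k$ is its length (the empty sequence is allowed when $\pi=\sigma$). $A_G(\pi,\sigma)$ is the set of all $G$-transformations of $\pi$ into $\sigma$; a minimum $G$-transformation is one of minimum length. $\omega$ is $G$-between $\pi$ and $\sigma$ if there is a minimum $G$-transformation $(g_1,\dots,g_k)$ of $\pi$ into $\sigma$ with $\omega=\pi g_1\cdots g_j$ for some $j\in[k]$. A function $\mathsf{d}:\mathbb{S}_n\times\mathbb{S}_n\to[0,\infty]$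 is a weighted $G$-distance if: 1. $\mathsf{d}$ is a pseudo-metric ($\mathsf{d}(\pi,\pi)=0$, symmetry, triangle inequality; distinct points may be at distance zero). 2. $\mathsf{d}$ is left-invariant: $\mathsf{d}(\sigma\pi,\sigma\omega)=\mathsf{d}(\pi,\omega)$ for all $\pi,\sigma,\omega\in\mathbb{S}_n$. 3. For any distinct $\pi,\sigma\in\mathbb{S}_n$ that are not $G$-adjacent, there exists an $\omega$ that is $G$-between $\pi$ and $\sigma$, distinct from both, such that $\mathsf{d}(\pi,\sigma)=\mathsf{d}(\pi,\omega)+\mathsf{d}(\omega,\sigma)$. *)

(* Defs.v *)
From mathcomp Require Import all_boot all_order all_algebra all_fingroup.
From mathcomp Require Import boolp classical_sets reals constructive_ereal.

Set Implicit Arguments.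
Unset Strict Implicit.
Unset Printing Implicit Defensive.

Import Order.TTheory GRing.Theory Num.Theory.

Local Open Scope classical_set_scope.
Local Open Scope ring_scope.
Local Open Scope ereal_scope.

(* MathComp's product of permutations applies the left factor first:
   (s * p) i = p (s i). The product p s of the mathematical text is the
   composition i |-> p (s i), hence the swapped factors. *)
Definition perm_comp (n : nat) (p s : 'S_n) : 'S_n := (s * p)%g.

Notation "p '\oS' s" := (perm_comp p s) (at level 40, left associativity).

Lemma perm_compE (n : nat) (p s : 'S_n) (i : 'I_n) : (p \oS s) i = p (s i).
Proof. by rewrite permM. Qed.

Definition transpositions (n : nat) : {set 'S_n} :=
  [set tperm ab.1 ab.2 | ab : 'I_n * 'I_n & ab.1 != ab.2]%SET.

Lemma transpositionsV (n : nat) (t : 'S_n) :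
  t \in transpositions n -> (t^-1)%g \in transpositions n.
Proof.
by case/imsetP=> ab hab ->; rewrite tpermV; apply: imset_f.
Qed.

(* p g_1 g_2 ... g_k, bracketed to the left *)
Definition apply_seq (n : nat) (p : 'S_n) (gs : seq 'S_n) : 'S_n :=
  foldl (@perm_comp n) p gs.

Section GDistance.

Variables (n : nat) (G : {set 'S_n}).

Definition adjacent (p s : 'S_n) : Prop := exists2 g, g \in G & p = s \oS g.

Definition transformations (p s : 'S_n) : set (seq 'S_n) :=
  [set gs | {in gs, forall g, g \in G} /\ s = apply_seq p gs].

Definition min_transformation (p s : 'S_n) (gs : seq 'S_n) : Prop :=
  transformations p s gs /\
  forall hs, transformations p s hs -> (size gs <= size hs)%N.

Definition between (p s w : 'S_n) : Prop :=
  exists gs, min_transformation p s gs /\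
    exists j : nat, (1 <= j <= size gs)%N /\ w = apply_seq p (take j gs).

Record weighted_distance (R : realType) (d : 'S_n -> 'S_n -> \bar R) : Prop :=
  WeightedDistance {
    wdist_ge0 : forall p s, 0 <= d p s ;
    wdist_refl : forall p, d p p = 0 ;
    wdist_sym : forall p s, d p s = d s p ;
    wdist_triangle : forall p s w, d p s <= d p w + d w s ;
    wdist_left_inv : forall p s w, d (s \oS p) (s \oS w) = d p w ;
    wdist_between : forall p s, p <> s -> ~ adjacent p s ->
      exists w, [/\ between p s w, w <> p, w <> s & d p s = d p w + d w s]
  }.

End GDistance.

Definition is_minimum (R : realType) (A : set (\bar R)) (x : \bar R) : Prop :=
  A x /\ lbound A x.

(* Main.v *)
(** The triangle inequality along a transformation, together with left invariance
    ([d (p g) p = d g e]), bounds [d p s] above by the cost of every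
    transformation. Conversely, axiom 3 splits [d p s] at a point of a minimum
    transformation, so induction on the length yields a transformation whose
    cost is exactly [d p s]. *)
Require Import Defs.
From mathcomp Require Import all_boot all_order all_algebra all_fingroup.
From mathcomp Require Import boolp classical_sets reals constructive_ereal.

Set Implicit Arguments.
Unset Strict Implicit.
Unset Printing Implicit Defensive.

Import Order.TTheory GRing.Theory Num.Theory.

Local Open Scope classical_set_scope.
Local Open Scope ring_scope.
Local Open Scope ereal_scope.

Lemma apply_seq_cat (n : nat) (p : 'S_n) (gs hs : seq 'S_n) :
  apply_seq p (gs ++ hs) = apply_seq (apply_seq p gs) hs.
Proof. exact: foldl_cat. Qed.

(** Since [perm_comp] swaps the factors of the group product, the steps appear in reverse order,
    with [p] last. *)
Lemma apply_seqE (n : nat) (p : 'S_n) (gs : seq 'S_n) :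
  apply_seq p gs = ((\prod_(g <- rev gs) g) * p)%g.
Proof.
elim: gs p => [|g gs IH] p /=; first by rewrite big_nil mul1g.
by rewrite IH rev_cons big_rcons mulgA.
Qed.

Lemma transformations_cat (n : nat) (G : {set 'S_n}) (p w s : 'S_n)
    (gs hs : seq 'S_n) :
  transformations G p w gs -> transformations G w s hs ->
  transformations G p s (gs ++ hs).
Proof.
move=> [Ggs ->] [Ghs ->]; split; last by rewrite apply_seq_cat.
by move=> g; rewrite mem_cat => /orP[/Ggs | /Ghs].
Qed.

Lemma transformations_take_drop (n : nat) (G : {set 'S_n}) (p s : 'S_n)
    (gs : seq 'S_n) (j : nat) :
  transformations G p s gs ->
  transformations G p (apply_seq p (take j gs)) (take j gs) /\
  transformations G (apply_seq p (take j gs)) s (drop j gs).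
Proof.
move=> [Ggs ->]; split; split=> //; last by rewrite -apply_seq_cat cat_take_drop.
- by move=> g /mem_take /Ggs.
- by move=> g /mem_drop /Ggs.
Qed.

Lemma min_transformation_exists (n : nat) (G : {set 'S_n}) (p s : 'S_n) :
  (exists gs, transformations G p s gs) -> exists gs, min_transformation G p s gs.
Proof.
move=> [gs Tgs].
(* [ex_minnP] takes a boolean predicate on lengths, hence the classical reflection. *)
pose P k := `[< exists2 hs, transformations G p s hs & size hs = k >].
have exP : exists k, P k by exists (size gs); apply/asboolP; exists gs.
case: (ex_minnP exP) => k /asboolP[hs Ths <-] hmin.
by exists hs; split=> // ks Tks; apply: hmin; apply/asboolP; exists ks.
Qed.

(** It suffices to factor [s * p^-1], which is $p^{-1}s$ in composition order, into
    transpositions. *)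
Lemma transpositions_generate (n : nat) (p s : 'S_n) :
  exists ts, transformations (transpositions n) p s ts.
Proof.
have [ts def_s ts_diff] := prod_tpermP (s * p^-1)%g.
exists (rev [seq tperm t.1 t.2 | t <- ts]); split.
  move=> g; rewrite mem_rev => /mapP[t t_ts ->].
  by apply: imset_f; rewrite inE; exact: (allP ts_diff).
by rewrite apply_seqE revK big_map -def_s mulgKV.
Qed.

(** The point reached after the first step [g] of a minimum transformation works: it differs from
    [p] because [g] is not the identity, and from [s] because otherwise [p = s \oS g^-1] would be
    adjacent to [s]. *)
Lemma between_exists (n : nat) (G : {set 'S_n}) (p s : 'S_n) :
  1%g \notin G -> {in G, forall g, g^-1%g \in G} ->
  (exists gs, transformations G p s gs) -> p <> s -> ~ adjacent G p s ->
  exists w, [/\ between G p s w, w <> p & w <> s].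
Proof.
move=> G1 GV /min_transformation_exists[[|g gs] [[Ggs def_s] mgs]] ps nadj.
  by case: ps.
have Gg : g \in G by apply: Ggs; rewrite mem_head.
exists (p \oS g); split.
- by exists (g :: gs); split=> //; exists 1%N; rewrite /= take0.
- rewrite -[RHS]mul1g => /mulIg g1.
  by move: G1; rewrite -g1 Gg.
- move=> wE; apply: nadj; exists g^-1%g; first exact: GV.
  by rewrite -wE /perm_comp mulKg.
Qed.

(** The zero pseudo-metric serves as the existence witness. Its values make axiom 3 purely a matter
    of finding an intermediate point. *)
Lemma weighted_distance0 (R : realType) (n : nat) (G : {set 'S_n}) :
  1%g \notin G -> {in G, forall g, g^-1%g \in G} ->
  (forall p s, exists gs, transformations G p s gs) ->
  weighted_distance G (fun _ _ : 'S_n => 0 : \bar R).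
Proof.
move=> G1 GV gen; split=> // [p s w | p s ps nadj]; first by rewrite adde0.
have [w [? ? ?]] := between_exists G1 GV (gen p s) ps nadj.
by exists w; split=> //; rewrite adde0.
Qed.

Lemma wdist_step (R : realType) (n : nat) (G : {set 'S_n})
    (d : 'S_n -> 'S_n -> \bar R) (p g : 'S_n) :
  weighted_distance G d -> d p (p \oS g) = d g 1%g.
Proof.
move=> dW; rewrite (wdist_sym dW) -(wdist_left_inv dW g p 1%g).
by rewrite {3}/perm_comp mul1g.
Qed.

Lemma wdist_le_cost (R : realType) (n : nat) (G : {set 'S_n})
    (d : 'S_n -> 'S_n -> \bar R) (p : 'S_n) (gs : seq 'S_n) :
  weighted_distance G d -> d p (apply_seq p gs) <= \sum_(g <- gs) d g 1%g.
Proof.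
move=> dW; elim: gs p => [|g gs IH] p /=.
  by rewrite big_nil (wdist_refl dW).
rewrite big_cons -(wdist_step p g dW).
by apply: le_trans (wdist_triangle dW _ _ (p \oS g)) _; rewrite leeD2l.
Qed.

Lemma wdist_cost_attained (R : realType) (n : nat) (G : {set 'S_n})
    (d : 'S_n -> 'S_n -> \bar R) (p s : 'S_n) :
  {in G, forall g, g^-1%g \in G} -> weighted_distance G d ->
  (exists gs, transformations G p s gs) ->
  exists2 ts, transformations G p s ts & \sum_(t <- ts) d t 1%g = d p s.
Proof.
(* The induction bounds the length of an arbitrary transformation, so the two pieces of a minimum
   one need not be shown minimum themselves. *)
move=> GV dW [gs]; have [k] := ubnP (size gs).
elim: k => // k IH in p s gs *; rewrite ltnS => gs_k Tgs.
have [<-|ps] := pselect (p = s).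
  by exists [::]; rewrite ?big_nil ?(wdist_refl dW).
have [[g Gg def_p]|nadj] := pselect (adjacent G p s).
  (* Adjacency reads [p = s \oS g], so the single step from [p] to [s] is the inverse of [g]. *)
  have def_s : s = p \oS g^-1%g by rewrite def_p /perm_comp mulKg.
  exists [:: g^-1%g]; last by rewrite big_seq1 def_s (wdist_step _ _ dW).
  by split=> // h; rewrite inE => /eqP->; exact: GV.
have [w [[hs [[Ths mhs] [j [/andP[j_gt0 j_le] def_w]]]] _ ws ->]] :=
  wdist_between dW ps nadj.
have hs_k : (size hs <= k)%N := leq_trans (mhs _ Tgs) gs_k.
(* Betweenness allows [j = size hs], which [w <> s] excludes. Together with [1 <= j], this makes
   both pieces strictly shorter than [hs]. *)
have j_lt : (j < size hs)%N.
  rewrite ltn_neqAle j_le andbT; apply/eqP => j_eq.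
  by apply: ws; rewrite def_w j_eq take_size -Ths.2.
have [] := transformations_take_drop j Ths; rewrite -def_w => Tpw Tws.
have [|ts1 T1 <-] := IH _ _ _ _ Tpw.
  by rewrite size_takel // (leq_trans j_lt).
have [|ts2 T2 <-] := IH _ _ _ _ Tws.
  by rewrite size_drop (leq_trans _ hs_k) // ltn_subrL j_gt0 (leq_trans _ j_lt).
by exists (ts1 ++ ts2); [exact: transformations_cat T1 T2 | rewrite big_cat].
Qed.

Lemma transpositions_neq1 (n : nat) : 1%g \notin transpositions n.
Proof.
apply/imsetP => -[[a b]]; rewrite inE /= => /eqP ab t1; apply: ab.
by rewrite -(tpermR a b) -t1 perm1.
Qed.

Theorem theorem22 (R : realType) (n : nat) (hn : (1 <= n)%N) :
  [/\ exists d : 'S_n -> 'S_n -> \bar R, weighted_distance (transpositions n) d,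
      forall d1 d2 : 'S_n -> 'S_n -> \bar R,
        weighted_distance (transpositions n) d1 ->
        weighted_distance (transpositions n) d2 ->
        (forall t, t \in transpositions n -> d1 t 1%g = d2 t 1%g) ->
        forall p s, d1 p s = d2 p s
    & forall d : 'S_n -> 'S_n -> \bar R,
        weighted_distance (transpositions n) d ->
        forall p s : 'S_n,
          is_minimum
            [set \sum_(t <- ts) d t 1%g
              | ts in transformations (transpositions n) p s]
            (d p s)].
Proof.
have GV := @transpositionsV n; have gen := @transpositions_generate n.
have dmin (d : 'S_n -> 'S_n -> \bar R) : weighted_distance (transpositions n) d -> forall p s : 'S_n,
    is_minimum [set \sum_(t <- ts) d t 1%g
                 | ts in transformations (transpositions n) p s] (d p s).
  move=> dW p s; split; last by move=> _ [ts [_ ->] <-]; exact: wdist_le_cost dW.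
  by have [ts] := wdist_cost_attained GV dW (gen p s); exists ts.
split=> //.
  by exists (fun _ _ => 0); exact: weighted_distance0 (transpositions_neq1 n) GV gen.
(* Uniqueness by two inequalities: a transformation attaining [d2 p s] has the same cost under [d1],
   and that cost bounds [d1 p s] from above. Exchanging the roles gives the converse. *)
have le12 (d1 d2 : 'S_n -> 'S_n -> \bar R) : weighted_distance (transpositions n) d1 ->
    weighted_distance (transpositions n) d2 ->
    {in transpositions n, forall t, d1 t 1%g = d2 t 1%g} ->
    forall p s, d1 p s <= d2 p s.
  move=> d1W d2W d12 p s; have [[ts [Gts def_s] <-] _] := dmin _ d2W p s.
  rewrite (eq_big_seq (fun t => d1 t 1%g)) => [|t /Gts /d12 //].
  by rewrite def_s; exact: wdist_le_cost d1W.
move=> d1 d2 d1W d2W d12 p s; apply/le_anti/andP; split; apply: le12 => //.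
by move=> t /d12.
Qed.
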